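(* In the case $t=1$ (no collusion), with untruncated Gaussian noise, the distinguishing security metric $\eta_s$ of the protocol described in the context satisfies $$\eta_s\le\sqrt{2\left(1-\exp\left(-\frac{r^2}{\sigma_n^2}\right)\right)},$$ where $r$ is the maximum absolute value of the secret and $\sigma_n^2$ is the variance of the noise used in the protocol. In particular, when $r=o(\sigma_n)$, $$\eta_s\le\sqrt2\,\frac{r}{\sigma_n}+o\left(\frac{r}{\sigma_n}\right).$$
   Context: Protocol with $t=1$: the secret $S$ is a real random variable taking values in $[-r,r]$. There are $N$ parties, and party $i\in\{1,\dots,N\}$ receives $Y_i=S+\omega_i n_1$, where $\omega_i=\exp(2\pi\sqrt{-1}\,i/N)$ and $n_1$, independent of $S$, is a zero-mean circularly symmetric complex Gaussian random variable with variance $\mathbb{E}|n_1|^2=\sigma_n^2$ (real and imaginary parts independent, each of variance $\sigma_n^2/2$). The total variation distance of probability measures $P_1,P_2$ on a $\sigma$-algebra $\mathcal{F}$ is $D_{\mathrm{TV}}(P_1,P_2)=\sup_{A\in\mathcal{F}}|P_1(A)-P_2(A)|$. The distinguishing security (DS) metric is $$\eta_s=\max_i\ \max_{s_1,s_2\in\mathbb{D}_S}D_{\mathrm{TV}}\left(P_{Y_i|S=s_1},P_{Y_i|S=s_2}\right),$$ where $\mathbb{D}_S\subseteq[-r,r]$ is the support of $S$. *)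

(* Defs.v *)
From HB Require Import structures.
From mathcomp Require Import all_boot all_order all_algebra.
From mathcomp Require Import complex.
From mathcomp Require Import all_classical all_reals all_analysis.
Set Implicit Arguments.
Unset Strict Implicit.
Unset Printing Implicit Defensive.
Import Order.TTheory GRing.Theory Num.Theory.
Import numFieldNormedType.Exports.
Local Open Scope classical_set_scope.
Local Open Scope ring_scope.
Local Open Scope complex_scope.

(* The Borel sigma-algebra of R[i], through the identification of R[i] with
   R * R. *)
Definition complex_pair (R : Type) (z : R[i]) : R * R :=
  (complex.Re z, complex.Im z).

Definition measurable_complex (R : realType) : set (set R[i]) :=
  preimage_set_system setT (@complex_pair R) measurable.

Fact measurable_complex_sigma_algebra (R : realType) :
  sigma_algebra setT (@measurable_complex R).
Proof. exact/sigma_algebra_preimage/sigma_algebra_measurable. Qed.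

Fact measurable_complex0 (R : realType) : @measurable_complex R set0.
Proof. by case: (measurable_complex_sigma_algebra R). Qed.

Fact measurable_complexC (R : realType) (A : set R[i]) :
  measurable_complex A -> measurable_complex (~` A).
Proof.
by case: (measurable_complex_sigma_algebra R) => _ + _ => /[apply]; rewrite setTD.
Qed.

Fact measurable_complex_bigcup (R : realType) (F : (set R[i])^nat) :
  (forall k, measurable_complex (F k)) -> measurable_complex (\bigcup_k F k).
Proof. by case: (measurable_complex_sigma_algebra R) => _ _; exact. Qed.

Fact complex_display : measure_display. Proof. exact. Qed.

HB.instance Definition _ (R : realType) := isPointed.Build R[i] 0.

HB.instance Definition _ (R : realType) :=
  isMeasurable.Build complex_display R[i]
    (@measurable_complex0 R) (@measurable_complexC R)
    (@measurable_complex_bigcup R).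

Definition cexp (R : realType) (z : R[i]) : R[i] :=
  (expR (complex.Re z))%:C * (cos (complex.Im z) +i* sin (complex.Im z)).

Definition total_variation_dist d (T : measurableType d) (R : realType)
    (P1 P2 : set T -> \bar R) : \bar R :=
  ereal_sup [set `|P1 A - P2 A|%E | A in measurable].

Section random_variables.
Context d (Omega : measurableType d) (R : realType) (P : probability Omega R).

Definition independent_rv d1 (T1 : measurableType d1) d2 (T2 : measurableType d2)
    (X1 : Omega -> T1) (X2 : Omega -> T2) : Prop :=
  forall A B, measurable A -> measurable B ->
    P (X1 @^-1` A `&` X2 @^-1` B) = (P (X1 @^-1` A) * P (X2 @^-1` B))%E.

(* Zero mean and E|Z|^2 = sigma ^+ 2; each component has standard deviation
   sigma / sqrt 2. *)
Definition circular_gaussian (sigma : R) (Z : Omega -> R[i]) : Prop :=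
  let X := fun w => complex.Re (Z w) in
  let Y := fun w => complex.Im (Z w) in
  [/\ independent_rv X Y,
      forall A, measurable A ->
        P (X @^-1` A) = normal_prob 0 (Num.sqrt (sigma ^+ 2 / 2)) A &
      forall A, measurable A ->
        P (Y @^-1` A) = normal_prob 0 (Num.sqrt (sigma ^+ 2 / 2)) A].

Definition support_rv (S : Omega -> R) : set R :=
  [set s | forall e : R, 0 < e -> (0 < P (S @^-1` ball s e))%E].

(* P_{Y|S=s}, for s in the support of S.  A regular conditional distribution is
   only determined for almost every s; here the value at each point s of the
   support is the limit of the elementary conditional probabilities given
   |S - s| < e, which all condition on events of positive probability.  It is
   the elementary conditional probability whenever P (S = s) > 0. *)
Definition cond_law dT (T : measurableType dT) (S : Omega -> R) (Y : Omega -> T)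
    (s : R) (A : set T) : \bar R :=
  lim ((P (S @^-1` ball s e `&` Y @^-1` A) / P (S @^-1` ball s e))%E
         @[e --> 0^'+]).

End random_variables.

Record protocol (R : realType) := Protocol {
  disp : measure_display ;
  Omega : measurableType disp ;
  Pr : probability Omega R ;
  parties : nat ;
  range_bound : R ;
  noise_std : R ;
  secret : {RV Pr >-> R} ;
  noise : {RV Pr >-> R[i]} ;
  parties_gt0 : (0 < parties)%N ;
  noise_std_gt0 : 0 < noise_std ;
  secret_bounded : forall w, - range_bound <= secret w <= range_bound ;
  noise_gaussian : circular_gaussian Pr noise_std noise ;
  secret_noise_indep : independent_rv Pr secret noise
}.

Section protocol_theory.
Context (R : realType) (p : protocol R).

Definition omega (i : nat) : R[i] :=
  cexp ((2 * pi * i%:R / (parties p)%:R) *i).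

Definition share (i : nat) (w : Omega p) : R[i] :=
  (secret p w)%:C + omega i * noise p w.

(* As the secret and the noise are independent and translations of a Gaussian
   law are continuous in total variation, the limit exists and is the law of
   s + omega i * noise. *)
Definition share_law (i : nat) (s : R) : set R[i] -> \bar R :=
  cond_law (Pr p) (secret p) (share i) s.

(* The default value -oo of the maximum is harmless since there is at least one
   party. *)
Definition ds_metric : \bar R :=
  \big[maxe/-oo%E]_(1 <= i < (parties p).+1)
    ereal_sup [set total_variation_dist (share_law i s1) (share_law i s2) |
                 s1 in support_rv (Pr p) (secret p) &
                 s2 in support_rv (Pr p) (secret p)].

End protocol_theory.

(* Main.v *)
(* Conditioning on the secret being within e of a support point s and letting e
   tend to 0 yields the law of s + omega_i * noise, because the secret and the
   noise are independent and Gaussian laws depend continuously on their mean.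
   Two such laws are isotropic Gaussians of the plane with variance sigma^2 / 2
   per coordinate and means at distance |s1 - s2| <= 2 r; their Hellinger
   affinity is exp (- |s1 - s2|^2 / (4 sigma^2)) >= exp (- r^2 / sigma^2), and
   TV <= sqrt (2 (1 - affinity)).  Since 1 - exp (- x^2) <= x^2, the asymptotic
   bound holds with a zero error term. *)
Require Import Defs.
From HB Require Import structures.
From mathcomp Require Import all_boot all_order all_algebra.
From mathcomp Require Import complex.
From mathcomp Require Import all_classical all_reals all_analysis.
From mathcomp Require Import measurable_realfun ring lra.
Set Implicit Arguments.
Unset Strict Implicit.
Unset Printing Implicit Defensive.
Import Order.TTheory GRing.Theory Num.Theory.
Import numFieldNormedType.Exports.
Local Open Scope classical_set_scope.
Local Open Scope ring_scope.

(** * Measures defined by a density *)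

Section density_measure.
Local Open Scope ereal_scope.
Context d (T : measurableType d) (R : realType).
Variables (mu : {measure set T -> \bar R}) (f : T -> \bar R).

(** The side conditions are arguments, so that the measure structure attaches to the term itself. *)
Definition density_measure of measurable_fun setT f & (forall x, 0 <= f x) :=
  fun A : set T => \int[mu]_(x in A) f x.

Hypotheses (mf : measurable_fun setT f) (f0 : forall x, 0 <= f x).
Local Notation nu := (density_measure mf f0).

Let density_measure0 : nu set0 = 0.
Proof. exact: integral_set0. Qed.

Let density_measure_ge0 A : 0 <= nu A.
Proof. by apply: integral_ge0 => x _; exact: f0. Qed.

Let density_measure_sigma_additive : semi_sigma_additive nu.
Proof.
move=> A mA tA mUA; rewrite /density_measure ge0_integral_bigcup//=.
- by apply: is_cvg_ereal_nneg_natsum_cond => n _ _; apply: integral_ge0.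
- exact: measurable_funTS.
Qed.

HB.instance Definition _ := isMeasure.Build _ _ _ nu
  density_measure0 density_measure_ge0 density_measure_sigma_additive.

End density_measure.

(** * Gaussian laws on the line and the plane: translations and densities *)

Section gaussian_plane.
Context (R : realType).
Implicit Types (a b s x y : R).
Local Notation leb := (@lebesgue_measure R).

Lemma lebesgue_measure_translation a (A : set R) : measurable A ->
  leb ((fun x => x + a) @^-1` A) = leb A.
Proof.
move=> mA.
have mt : measurable_fun [set: measurableTypeR R]
    ((fun x => x + a) : measurableTypeR R -> measurableTypeR R).
  exact: measurable_funD.
pose tr : {mfun measurableTypeR R >-> measurableTypeR R} :=
  HB.pack (fun x : measurableTypeR R => x + a : measurableTypeR R)
    (isMeasurableFun.Build _ _ _ _ _ mt).
rewrite (_ : leb ((fun x => x + a) @^-1` A) = pushforward leb tr A)//.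
apply/esym/lebesgue_measure_unique => //= _ [[u v]] _ <-.
rewrite /pushforward /=.
rewrite (_ : _ @^-1` _ = `](u - a), (v - a)]%classic); last first.
  by apply/seteqP; split => x /=; rewrite !in_itv/= ltrBlDr lerBrDr.
rewrite !lebesgue_measure_itv/= !lte_fin ltrD2r -!EFinD.
by case: ifP => // _; congr EFin; ring.
Qed.

Lemma normal_prob_translation a s (A : set R) : s != 0 -> measurable A ->
  normal_prob 0 s ((fun x => x + a) @^-1` A) = normal_prob a s A.
Proof.
move=> s0 mA.
have mt : measurable_fun [set: measurableTypeR R]
    ((fun x => x + a) : measurableTypeR R -> measurableTypeR R).
  exact: measurable_funD.
have mpdf b : measurable_fun [set: measurableTypeR R] (EFin \o normal_pdf b s).
  by apply/measurable_EFinP; exact: measurable_normal_pdf.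
transitivity (\int[pushforward leb
    ((fun x => x + a)%R : measurableTypeR R -> measurableTypeR R)]_(x in A)
      (normal_pdf a s x)%:E)%E.
  rewrite ge0_integral_pushforward//.
  - apply: eq_integral => x _ /=; rewrite !normal_pdfE// /normal_fun.
    by rewrite addrK subr0.
  - by apply: measurable_funTS; exact: mpdf.
  - by move=> x _; rewrite lee_fin normal_pdf_ge0.
apply: eq_measure_integral => B mB _.
exact: lebesgue_measure_translation.
Qed.

Lemma measurable_normal_pdf_prod a b s :
  measurable_fun setT
    (fun z : measurableTypeR R * measurableTypeR R =>
       (normal_pdf a s z.1 * normal_pdf b s z.2)%:E).
Proof.
apply/measurable_EFinP; apply: measurable_funM; apply: measurableT_comp => //;
  exact: measurable_normal_pdf.
Qed.

(** The right-hand side is a measure in [B], through [density_measure]. By Tonelli it has product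
    values on rectangles, and these determine the product measure. *)
Lemma normal_prob_prodE a b s (B : set (R * R)) : measurable B ->
  (normal_prob a s \x normal_prob b s)%E B =
  (\int[leb \x leb]_(z in B) (normal_pdf a s z.1 * normal_pdf b s z.2)%:E)%E.
Proof.
have f0 z : (0 <= (normal_pdf a s z.1 * normal_pdf b s z.2)%:E)%E.
  by rewrite lee_fin mulr_ge0 ?normal_pdf_ge0.
pose m : {measure set _ -> \bar R} :=
  density_measure (leb \x leb)%E (measurable_normal_pdf_prod a b s) f0.
pose g c := EFin \o normal_pdf c s : measurableTypeR R -> \bar R.
have mg c (C : set (measurableTypeR R)) :
    measurable C -> measurable_fun setT (g c \_ C).
  move=> mC; have mgc : measurable_fun setT (g c).
    by apply/measurable_EFinP; exact: measurable_normal_pdf.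
  have := @measurable_funTS _ _ _ _ C _ mgc.
  by move/(measurable_restrictT _ mC).
have g0 c (C : set (measurableTypeR R)) x : (0 <= (g c \_ C) x)%E.
  by apply: erestrict_ge0 => ? _; rewrite lee_fin normal_pdf_ge0.
move=> mB; rewrite (@product_measure_unique _ _ _ _ _ _ _ m)//.
move=> C D mC mD; rewrite /m /= /density_measure integral_mkcond.
rewrite fubini_tonelli1; last 2 first.
- apply/(measurable_restrictT _ _).1; first exact: measurableX.
  by apply: measurable_funTS; exact: measurable_normal_pdf_prod.
- by move=> z; apply: erestrict_ge0 => ? _; exact: f0.
rewrite /normal_prob (integral_mkcond C) (integral_mkcond D) -/(g a) -/(g b).
rewrite -(ge0_integralZr _ _ (mg a C mC)); [|by []|by move=> x _; exact: g0|];
  last by apply: integral_ge0 => x _; exact: g0.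
apply: eq_integral => x _.
rewrite -(ge0_integralZl _ _ (mg b D mD));
  [|by []|by move=> y _; exact: g0|exact: g0].
apply: eq_integral => y _.
rewrite !patchE in_setX /=.
by case: (x \in C); case: (y \in D); rewrite ?mule0 ?mul0e.
Qed.

(** A translation acts on rectangles factor by factor, so the one-dimensional case and uniqueness of
    product measures suffice. *)
Lemma normal_prob_prod_translation a b s (B : set (R * R)) :
  s != 0 -> measurable B ->
  (normal_prob 0 s \x normal_prob 0 s)%E ((fun z => (z.1 + a, z.2 + b)) @^-1` B)
  = (normal_prob a s \x normal_prob b s)%E B.
Proof.
move=> s0 mB.
have mt : measurable_fun [set: measurableTypeR R * measurableTypeR R]
    (fun z => (z.1 + a, z.2 + b) : measurableTypeR R * measurableTypeR R).
  by apply: measurable_fun_pair; exact: measurable_funD.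
pose tr : {mfun (measurableTypeR R * measurableTypeR R)%type >->
                (measurableTypeR R * measurableTypeR R)%type} :=
  HB.pack (fun z : measurableTypeR R * measurableTypeR R =>
             (z.1 + a, z.2 + b) : measurableTypeR R * measurableTypeR R)
    (isMeasurableFun.Build _ _ _ _ _ mt).
pose N0 : {sigma_finite_measure set (measurableTypeR R) -> \bar R} :=
  normal_prob 0 s.
suff H C D : measurable C -> measurable D ->
    pushforward (N0 \x N0)%E tr (C `*` D) =
    (normal_prob a s C * normal_prob b s D)%E.
  exact: esym (product_measure_unique H mB).
move=> mC mD; rewrite -(normal_prob_translation a s0 mC).
rewrite -(normal_prob_translation b s0 mD).
have mtr c (E : set (measurableTypeR R)) :
    measurable E -> measurable ((fun x : measurableTypeR R => x + c) @^-1` E).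
  move=> mE; rewrite -[X in measurable X]setTI.
  have mc : measurable_fun [set: measurableTypeR R]
    ((fun x => x + c) : measurableTypeR R -> measurableTypeR R).
    exact: measurable_funD.
  exact: mc.
exact: (product_measure1E N0 N0 (mtr a C mC) (mtr b D mD)).
Qed.

End gaussian_plane.

(** * From affinity to total variation *)

(** The right side minus the left is the square [(t * (u - v) - (u + v)) ^+ 2] over [2 * t]. It is
    used with [u] and [v] the square roots of two densities; the factor [1] matches the shape of
    [ge0_integral_lincomb]. *)
Lemma affinity_pointwise (R : realFieldType) (t u v : R) : 0 < t ->
  1 * u ^+ 2 + (t - t^-1) * (u * v) <=
  (1 + (t + t^-1) / 2) * v ^+ 2 + (t + t^-1) / 2 * u ^+ 2.
Proof.
move=> t0; rewrite -subr_ge0.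
rewrite (_ : _ - _ = (t * (u - v) - (u + v)) ^+ 2 / t / 2).
  by rewrite !divr_ge0 ?sqr_ge0 ?ltW.
by field; rewrite gt_eqF.
Qed.

(* [t = 2 / u] minimizes [t * (1 - rho) + 2 / t], an upper bound of the
   right-hand side. *)
Lemma le_of_quadratic_tradeoff (R : realFieldType) (c u rho : R) :
  c <= 1 -> 0 <= rho <= 1 -> 0 <= u -> u ^+ 2 = 2 * (1 - rho) ->
  (forall t, 1 <= t -> 2 * c <= t * (1 - rho) + (1 + rho) / t) -> c <= u.
Proof.
move=> c1 /andP[rho0 rho1] u0 u2 key.
have [{}u0|u0'] := ltP 0 u; last first.
  have {u0'}u0 : u = 0 by apply/eqP; rewrite eq_le u0' u0.
  have r1 : rho = 1 by move: u2; rewrite u0 expr0n/=; lra.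
  rewrite u0 leNgt; apply/negP => c0.
  (* With [rho = 1] the hypothesis reads [2 * c <= 2 / t]; at [t = 2 / c] it becomes [2 * c <= c],
     absurd for [c > 0]. *)
  have := key (2 / c); rewrite r1 subrr mulr0 add0r invf_div ler_pdivlMr//.
  by lra.
(* This makes [t = 2 / u] admissible, as [t] must be at least 1. *)
have u_le2 : u <= 2.
  rewrite -(@ler_pXn2r _ 2) ?nnegrE ?(ltW u0)// u2.
  by rewrite expr2; lra.
have := key (2 / u); rewrite ler_pdivlMr// mul1r => /(_ u_le2).
rewrite invf_div (_ : 1 - rho = u ^+ 2 / 2); last by lra.
rewrite (_ : 2 / u * (u ^+ 2 / 2) = u); last by field; rewrite gt_eqF.
have : rho * u <= 1 * u by rewrite ler_pM2r.
lra.
Qed.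

Section hellinger.
Context d (T : measurableType d) (R : realType).
Implicit Types f g : T -> R.

Lemma ge0_integral_lincomb (mu : {measure set T -> \bar R}) (A : set T) f g
    (a b : R) : measurable A ->
  measurable_fun setT f -> (forall x, 0 <= f x) ->
  measurable_fun setT g -> (forall x, 0 <= g x) -> 0 <= a -> 0 <= b ->
  (\int[mu]_(x in A) (a * f x + b * g x)%:E =
   a%:E * \int[mu]_(x in A) (f x)%:E + b%:E * \int[mu]_(x in A) (g x)%:E)%E.
Proof.
move=> mA mf f0 mg g0 a0 b0.
have mEf : measurable_fun A (EFin \o f).
  by apply/measurable_EFinP; exact: measurable_funTS.
have mEg : measurable_fun A (EFin \o g).
  by apply/measurable_EFinP; exact: measurable_funTS.
rewrite -!ge0_integralZl//; try by move=> x _; rewrite lee_fin.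
under eq_integral do rewrite EFinD !EFinM.
rewrite ge0_integralD//.
- by move=> x _; rewrite mule_ge0// lee_fin.
- exact: measurable_funeM.
- by move=> x _; rewrite mule_ge0// lee_fin.
- exact: measurable_funeM.
Qed.

Definition has_density (mu : {measure set T -> \bar R}) (P : set T -> \bar R)
    (p : T -> R) : Prop :=
  [/\ measurable_fun setT p, forall x, 0 <= p x &
      forall A, measurable A -> P A = (\int[mu]_(x in A) (p x)%:E)%E].

(* Integrating [p - q <= (t (sqrt p - sqrt q)^2 + (sqrt p + sqrt q)^2 / t) / 2],
   arranged so that all terms are nonnegative; [rho * m] is [sqrt (p * q)]. *)
Lemma affinity_measure_le (mu : {measure set T -> \bar R})
    (P Q M : set T -> \bar R) (p q m : T -> R) (rho t : R) (A : set T) :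
  has_density mu P p -> has_density mu Q q -> has_density mu M m ->
  0 <= rho -> (forall x, p x * q x = (rho * m x) ^+ 2) ->
  1 <= t -> measurable A ->
  (P A + ((t - t^-1) * rho)%:E * M A <=
   (1 + (t + t^-1) / 2)%:E * Q A + ((t + t^-1) / 2)%:E * P A)%E.
Proof.
move=> [mp p0 Pp] [mq q0 Qq] [mm m0 Mm] rho0 pq t1 mA.
have t0 : 0 < t by exact: lt_le_trans t1.
have ti1 : t^-1 <= 1 by rewrite invf_le1.
have ti0 : 0 < t^-1 by rewrite invr_gt0.
rewrite -[X in (X + _ <= _)%E]mul1e Pp// Qq// Mm//.
(* Here [1 <= t] makes the coefficient of [M] nonnegative, as the splitting of the integral
   requires. *)
have k0 : 0 <= (t - t^-1) * rho by rewrite mulr_ge0// subr_ge0 (le_trans ti1).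
have c0 : 0 <= (t + t^-1) / 2 by lra.
have c1 : 0 <= 1 + (t + t^-1) / 2 by lra.
rewrite -!ge0_integral_lincomb//.
have mlin (f g : T -> R) (a b : R) : measurable_fun setT f ->
    measurable_fun setT g ->
    measurable_fun A (fun x => (a * f x + b * g x)%:E).
  move=> mf mg; apply/measurable_EFinP; apply: measurable_funTS.
  by apply: measurable_funD; exact: measurable_funM.
apply: ge0_le_integral => //.
- by move=> x _; rewrite lee_fin addr_ge0// mulr_ge0.
- exact: mlin.
- exact: mlin.
move=> x _; rewrite lee_fin.
have -> : (t - t^-1) * rho * m x = (t - t^-1) * (Num.sqrt (p x) * Num.sqrt (q x)).
  rewrite -sqrtrM// pq sqrtr_sqr ger0_norm ?mulr_ge0//; ring.
have := sqr_sqrtr (p0 x); have := sqr_sqrtr (q0 x).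
move: (Num.sqrt (p x)) (Num.sqrt (q x)) => u v <- <-.
exact: affinity_pointwise.
Qed.

(** Since [m] is a probability density and [rho * m] is the geometric mean of [p] and [q], [rho] is
    their affinity. Adding [affinity_measure_le] on [A] to its version on the complement with [P]
    and [Q] exchanged, and using total masses 1, gives [key]; it remains to choose [t]. *)
Lemma hellinger_bound (mu : {measure set T -> \bar R}) (P Q M : probability T R)
    (p q m : T -> R) (rho : R) (A : set T) :
  has_density mu P p -> has_density mu Q q -> has_density mu M m ->
  0 <= rho <= 1 -> (forall x, p x * q x = (rho * m x) ^+ 2) ->
  measurable A ->
  fine (P A) - fine (Q A) <= Num.sqrt (2 * (1 - rho)).
Proof.
move=> dP dQ dM /andP[rho0 rho1] pq mA.
have fE (N : probability T R) B : measurable B -> N B = (fine (N B))%:E.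
  by move=> mB; rewrite fineK// fin_num_measure.
have f01 (N : probability T R) B : measurable B -> 0 <= fine (N B) <= 1.
  by move=> mB; rewrite -!lee_fin -fE// measure_ge0 probability_le1.
have fC (N : probability T R) : fine (N (~` A)) = 1 - fine (N A).
  by rewrite probability_setC// fineB ?fin_num_measure.
have key t : 1 <= t ->
    2 * (fine (P A) - fine (Q A)) <= t * (1 - rho) + (1 + rho) / t.
  move=> t1.
  have := affinity_measure_le dP dQ dM rho0 pq t1 mA.
  have qp x : q x * p x = (rho * m x) ^+ 2 by rewrite mulrC.
  have := affinity_measure_le dQ dP dM rho0 qp t1 (measurableC mA).
  rewrite (fE P A)// (fE Q A)// (fE M A)//.
  have mAC := measurableC mA.
  rewrite (fE P (~` A))// (fE Q (~` A))// (fE M (~` A))//.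
  rewrite -!EFinM -!EFinD !lee_fin !fC /=.
  by move: (t^-1) (fine _) (fine _) (fine _) => ti x y z; lra.
have /andP[b0 b1] := f01 Q A mA; have /andP[a0 a1] := f01 P A mA.
apply: (@le_of_quadratic_tradeoff _ _ _ rho) => //.
- by move: (fine _) (fine _) a1 b0 => x y; lra.
- by rewrite rho0.
- by rewrite sqr_sqrtr// mulr_ge0// subr_ge0.
Qed.

End hellinger.

(** * Affinity of shifted Gaussians and of noisy shares *)

Section gaussian_share.
Context (R : realType).
Implicit Types (a b c d s x y : R).
Local Notation leb := (@lebesgue_measure R).

(** Completing the square: [(x - a) ^+ 2 + (x - b) ^+ 2] is twice the squared distance from [x] to
    the midpoint plus [(a - b) ^+ 2 / 2]. The normalized geometric mean is thus the Gaussian at the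
    midpoint, and the exponential factor is the affinity. *)
Lemma normal_pdf_mid a b s x : s != 0 ->
  normal_pdf a s x * normal_pdf b s x =
  (expR (- ((a - b) ^+ 2 / (8 * s ^+ 2))) * normal_pdf ((a + b) / 2) s x) ^+ 2.
Proof.
move=> s0; rewrite !normal_pdfE// /normal_fun.
rewrite [in RHS]mulrCA [in RHS]exprMn -[in RHS]expRD mulrACA -expRD.
rewrite -[in RHS]expRM_natl; congr (_ * expR _).
by field.
Qed.

(** Affinities multiply over independent coordinates, so the squared mean differences add up in the
    exponent. *)
Lemma normal_prob_prod_tv a b a' b' s (B : set (R * R)) :
  s != 0 -> measurable B ->
  fine ((normal_prob a s \x normal_prob b s)%E B) -
  fine ((normal_prob a' s \x normal_prob b' s)%E B) <=
  Num.sqrt (2 * (1 - expR (- (((a - a') ^+ 2 + (b - b') ^+ 2) / (8 * s ^+ 2))))).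
Proof.
move=> s0 mB.
have dN u v : has_density (leb \x leb)%E (normal_prob u s \x normal_prob v s)%E
    (fun z => normal_pdf u s z.1 * normal_pdf v s z.2).
  split.
  - by apply/measurable_EFinP; exact: measurable_normal_pdf_prod.
  - by move=> z; rewrite mulr_ge0 ?normal_pdf_ge0.
  - by move=> A; exact: normal_prob_prodE.
apply: (hellinger_bound (dN a b) (dN a' b')
  (dN ((a + a') / 2) ((b + b') / 2))) => //.
  rewrite expR_ge0/= -expR0 ler_expR oppr_le0 divr_ge0 ?addr_ge0 ?sqr_ge0//.
  by rewrite mulr_ge0 ?sqr_ge0.
move=> z; rewrite mulrACA (normal_pdf_mid a a')// (normal_pdf_mid b b')//.
rewrite -exprMn; congr (_ ^+ 2).
by rewrite mulrACA -expRD -opprD -mulrDl.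
Qed.

(* [(c, d)] is [omega i] and [z] is the noise, both in coordinates. *)
Definition share_map c d (s : R) (z : R * R) : R * R :=
  (s + (c * z.1 - d * z.2), c * z.2 + d * z.1).

Lemma measurable_share_map c d :
  measurable_fun setT
    (fun w : measurableTypeR R * (measurableTypeR R * measurableTypeR R) =>
       share_map c d w.1 w.2 : measurableTypeR R * measurableTypeR R).
Proof.
have m1 : measurable_fun setT
    (fun w : measurableTypeR R * (measurableTypeR R * measurableTypeR R) => w.2.1).
  exact: measurableT_comp.
have m2 : measurable_fun setT
    (fun w : measurableTypeR R * (measurableTypeR R * measurableTypeR R) => w.2.2).
  exact: measurableT_comp.
apply: measurable_fun_pair.
  apply: measurable_funD => //.
  by apply: measurable_funB; apply: measurable_funM.
by apply: measurable_funD; apply: measurable_funM.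
Qed.

Lemma measurable_share_map_preimage c d t (B : set (R * R)) :
  measurable B -> measurable (share_map c d t @^-1` B).
Proof.
move=> mB; rewrite -[X in measurable X]setTI.
have mt : measurable_fun setT
    (fun z : measurableTypeR R * measurableTypeR R =>
      (t, z) : measurableTypeR R * (measurableTypeR R * measurableTypeR R)).
  exact: measurable_fun_pair.
exact: (measurableT_comp (measurable_share_map c d) mt).
Qed.

(** The candidate for the conditional law of a share: [t] is the value of the secret and [s] the
    standard deviation of each noise coordinate. *)
Definition noisy_prob c d s (B : set (R * R)) t : R :=
  fine ((normal_prob 0 s \x normal_prob 0 s)%E (share_map c d t @^-1` B)).

(** As [(c, d)] is a unit vector, moving the secret by [t] amounts to moving the noise by [t] times
    the conjugate [(c, - d)]. Both probabilities then concern one event under two Gaussians whose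
    means are [|s1 - s2|] apart. *)
Lemma noisy_prob_tv c d s1 s2 s (B : set (R * R)) :
  c ^+ 2 + d ^+ 2 = 1 -> s != 0 -> measurable B ->
  `|noisy_prob c d s B s1 - noisy_prob c d s B s2| <=
  Num.sqrt (2 * (1 - expR (- ((s1 - s2) ^+ 2 / (8 * s ^+ 2))))).
Proof.
move=> cd s0 mB; set law := noisy_prob c d s B.
suff H u v : law u - law v <=
    Num.sqrt (2 * (1 - expR (- ((u - v) ^+ 2 / (8 * s ^+ 2))))).
  clearbody law; rewrite ler_norml lerNl opprB (H s1 s2) andbT.
  by rewrite -[s1 - s2]opprB sqrrN; exact: H.
have lawE t : law t = fine ((normal_prob (t * c) s \x normal_prob (- (t * d)) s)%E
    (share_map c d 0 @^-1` B)).
  rewrite /law /noisy_prob -(normal_prob_prod_translation (t * c) (- (t * d)) s0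
    (measurable_share_map_preimage c d 0 mB)).
  congr (fine (_ _)); apply/seteqP.
  suff E z : share_map c d t z = share_map c d 0 (z.1 + t * c, z.2 - t * d).
    by split=> z /=; rewrite E.
  rewrite /share_map/=; congr (_, _); last by ring.
  (* The first coordinate needs [t = t * (c ^+ 2 + d ^+ 2)]. *)
  by rewrite -[t in LHS]mulr1 -cd; ring.
rewrite !lawE.
apply: le_trans (normal_prob_prod_tv _ _ _ _ s0 _) _.
  exact: measurable_share_map_preimage.
have -> : (u * c - v * c) ^+ 2 + (- (u * d) - - (v * d)) ^+ 2 =
    (u - v) ^+ 2 * (c ^+ 2 + d ^+ 2) by ring.
by rewrite cd mulr1.
Qed.

End gaussian_share.

(** * Joint laws, supports and conditional laws as limits *)

Section independence.
Context d (Omega : measurableType d) (R : realType) (P : probability Omega R).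

Lemma independent_joint_law d1 d2 (T1 : measurableType d1) (T2 : measurableType d2)
    (X1 : Omega -> T1) (X2 : Omega -> T2)
    (m1 : {sigma_finite_measure set T1 -> \bar R})
    (m2 : {sigma_finite_measure set T2 -> \bar R}) :
  measurable_fun setT X1 -> measurable_fun setT X2 ->
  (forall A, measurable A -> P (X1 @^-1` A) = m1 A) ->
  (forall B, measurable B -> P (X2 @^-1` B) = m2 B) ->
  independent_rv P X1 X2 ->
  forall B, measurable B -> P ((fun w => (X1 w, X2 w)) @^-1` B) = (m1 \x m2)%E B.
Proof.
move=> mX1 mX2 lX1 lX2 ind B mB.
have mX : measurable_fun setT (fun w => (X1 w, X2 w)).
  exact: measurable_fun_pair.
pose X : {mfun Omega >-> (T1 * T2)%type} :=
  HB.pack (fun w => (X1 w, X2 w)) (isMeasurableFun.Build _ _ _ _ _ mX).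
rewrite (@product_measure_unique _ _ _ _ _ _ _ (pushforward P X))//.
move=> C D mC mD; rewrite /pushforward/= -lX1// -lX2// -ind//.
Qed.

(** A point outside the interval has a ball around it that [S] never enters, whereas balls around
    support points have positive probability. *)
Lemma support_rv_bounded (S : Omega -> R) (r s : R) :
  (forall w, - r <= S w <= r) -> support_rv P S s -> - r <= s <= r.
Proof.
move=> Sr sS.
suff H e : 0 < e -> exists w, `|s - S w| < e.
  apply/andP; split; rewrite leNgt; apply/negP => rs.
    have /H [w] : 0 < - r - s by rewrite subr_gt0.
    by have := Sr w; rewrite ltr_norml => /andP[? ?] /andP[? ?]; lra.
  have /H [w] : 0 < s - r by rewrite subr_gt0.
  by have := Sr w; rewrite ltr_norml => /andP[? ?] /andP[? ?]; lra.
move=> /sS; have [->|/set0P[w Bw] _] := eqVneq (S @^-1` ball s e) set0.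
  by rewrite measure0 ltxx.
by exists w.
Qed.

(** The elementary conditional probability is the average of [K] over the ball under the law of [S].
    The Lipschitz bound at [s] keeps it within [C * e] of [K s], which forces the limit. *)
Lemma cond_lawE dT (T : measurableType dT) (S : {RV P >-> R}) (Y : Omega -> T)
    (A : set T) (K : R -> R) (C s : R) :
  measurable_fun setT K -> (forall u, 0 <= K u) ->
  (forall u, `|K u - K s| <= C * `|u - s|) ->
  (forall U : set R, measurable U -> P (S @^-1` U `&` Y @^-1` A) =
    (\int[distribution P S]_(u in U) (K u)%:E)%E) ->
  support_rv P S s ->
  cond_law P S Y s A = (K s)%:E.
Proof.
move=> mK K0 KC PK sS.
have mball e : measurable (ball s e : set R) by exact: measurable_ball.
have pE e : P (S @^-1` ball s e) = distribution P S (ball s e) by [].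
have C0 : 0 <= C.
  by have := KC (s + 1); rewrite addrAC subrr add0r normr1 mulr1; apply: le_trans.
have bound e : 0 < e ->
    exists2 x, (P (S @^-1` ball s e `&` Y @^-1` A) / P (S @^-1` ball s e))%E = x%:E &
               `|x - K s| <= C * e.
  move=> e0; rewrite PK// pE; set D := distribution P S.
  have mKU : measurable_fun (ball s e : set R) (EFin \o K).
    by apply/measurable_EFinP; exact: measurable_funTS.
  have Db : D (ball s e) \is a fin_num by exact: fin_num_measure.
  have Dp : (0 < D (ball s e))%E by exact: sS.
  have Ke u : ball s e u -> K u <= K s + C * e /\ K s <= K u + C * e.
    move=> su; have : `|K u - K s| <= C * e.
      apply: le_trans (KC u) _; rewrite ler_wpM2l// distrC ltW//.
    by rewrite ler_norml => /andP[? ?]; lra.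
  have Ce0 : 0 <= C * e by rewrite mulr_ge0// ltW.
  have up : (\int[D]_(u in ball s e) (K u)%:E <= (K s + C * e)%:E * D (ball s e))%E.
    rewrite -integral_cst//; apply: ge0_le_integral => //=.
    - by move=> u _; rewrite lee_fin.
    - by move=> u /Ke[]; rewrite lee_fin.
  (* The error is added on the right instead of subtracted on the left, so that all integrands stay
     nonnegative. *)
  have lo : ((K s)%:E * D (ball s e) <=
      \int[D]_(u in ball s e) (K u)%:E + (C * e)%:E * D (ball s e))%E.
    rewrite -!integral_cst// -ge0_integralD//=.
    apply: ge0_le_integral => //=.
    - by move=> u _; rewrite lee_fin.
    - by apply: emeasurable_funD.
    - by move=> u /Ke[] _; rewrite -EFinD lee_fin.
    - by move=> u _; rewrite lee_fin.
  have Ifin : (\int[D]_(u in ball s e) (K u)%:E)%E \is a fin_num.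
    rewrite ge0_fin_numE; last by apply: integral_ge0 => u _; rewrite lee_fin.
    by rewrite (le_lt_trans up)// -(fineK Db) -EFinM ltry.
  move: up lo Dp; rewrite -(fineK Ifin) -(fineK Db).
  move: (fine (D _)) => p; move: (fine _) => i.
  rewrite -!EFinM -EFinD !lee_fin lte_fin => up lo p0.
  exists (i / p); first by rewrite inver gt_eqF// -EFinM.
  rewrite ler_norml lerBrDr lerBlDr ler_pdivlMr// ler_pdivrMr//.
  by apply/andP; split; lra.
have e_gt0 : \forall e \near 0^'+, (0 : R) < e by exact: nbhs_right_gt.
(* Dividing by [C + 1] covers the case [C = 0]. *)
have C1 : 0 < C + 1 by rewrite ltr_wpDl.
apply/cvg_lim => //; apply: cvg_EFin.
  by near=> e; have [|x -> _] := bound e; first by near: e.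
apply/cvgrPdist_le => eps eps0; near=> e.
have e0 : 0 < e by near: e.
have [x /= -> /= xs] := bound e e0; rewrite distrC (le_trans xs)//.
have : e < eps / (C + 1) by near: e; apply: nbhs_right_lt; exact: divr_gt0.
by rewrite ltr_pdivlMr// => ?; lra.
Unshelve. all: by end_near. Qed.

End independence.

(** * Conditional laws of the shares and their distance *)

Section protocol_metric.
Context (R : realType).

Lemma sqrt_one_sub_gauss_le (x : R) :
  Num.sqrt (2 * (1 - expR (- x ^+ 2))) <= Num.sqrt 2 * `|x|.
Proof.
rewrite -sqrtr_sqr -sqrtrM// ler_wsqrtr// ler_wpM2l//.
have := expR_ge1Dx (- x ^+ 2); lra.
Qed.

(** Linearizing the total variation bound provides the continuity in the secret that [cond_lawE]
    asks for. *)
Lemma noisy_prob_lipschitz (c d s : R) (B : set (R * R)) u v :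
  c ^+ 2 + d ^+ 2 = 1 -> s != 0 -> measurable B ->
  `|noisy_prob c d s B u - noisy_prob c d s B v| <=
  Num.sqrt 2 / (Num.sqrt 8 * `|s|) * `|u - v|.
Proof.
move=> cd s0 mB; apply: le_trans (noisy_prob_tv u v cd s0 mB) _.
have -> : (u - v) ^+ 2 / (8 * s ^+ 2) = ((u - v) / (Num.sqrt 8 * s)) ^+ 2.
  by rewrite expr_div_n exprMn sqr_sqrtr.
apply: le_trans (sqrt_one_sub_gauss_le _) _.
by rewrite normrM normfV normrM (ger0_norm (sqrtr_ge0 8)) mulrA mulrAC.
Qed.

Lemma measurable_share_event (c d : R) (U : set R) (B : set (R * R)) :
  measurable U -> measurable B ->
  measurable [set w : measurableTypeR R * (measurableTypeR R * measurableTypeR R) |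
    U w.1 /\ B (share_map c d w.1 w.2)].
Proof.
move=> mU mB.
rewrite (_ : mkset _ = (fst @^-1` U) `&`
    ((fun w : measurableTypeR R * (measurableTypeR R * measurableTypeR R) =>
       share_map c d w.1 w.2) @^-1` B)) //.
apply: measurableI.
  rewrite -[X in measurable X]setTI; exact: measurable_fst.
rewrite -[X in measurable X]setTI.
exact: (measurable_share_map c d).
Qed.

(** The value at [u] is the Gaussian mass of the section at [u] of a jointly measurable set. *)
Lemma measurable_noisy_prob (c d s : R) (B : set (R * R)) :
  measurable B -> measurable_fun setT (noisy_prob c d s B).
Proof.
move=> mB; apply/measurable_EFinP.
pose N0 : probability (measurableTypeR R) R := normal_prob 0 s.
pose NN : probability (measurableTypeR R * measurableTypeR R)%type R := (N0 \x N0)%E.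
have mW := measurable_share_event c d measurableT mB.
have := measurable_fun_xsection NN mW.
apply: eq_measurable_fun => u _ /=.
rewrite /noisy_prob fineK.
  congr (NN _); apply/seteqP; split => z; rewrite /xsection /= inE /=; first by case.
  by move=> ?; split.
apply: (fin_num_measure NN).
exact: measurable_share_map_preimage.
Qed.

Lemma measurable_complex_pair : measurable_fun setT (@complex_pair R).
Proof. by move=> _ B mB; exists B. Qed.

Variables (p : protocol R) (i : nat).
Let S := secret p.
Let sd := Num.sqrt (noise_std p ^+ 2 / 2).
Let c := complex.Re (omega p i).
Let d := complex.Im (omega p i).
Let N0 : probability (measurableTypeR R) R := normal_prob 0 sd.
Let NN : probability (measurableTypeR R * measurableTypeR R)%type R := (N0 \x N0)%E.

Lemma omega_norm : c ^+ 2 + d ^+ 2 = 1.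
Proof.
by rewrite /c /d /omega /cexp /= expR0 !mul1r !mul0r subr0 addr0 cos2Dsin2.
Qed.

Lemma noise_sd_neq0 : sd != 0.
Proof.
by rewrite gt_eqF// sqrtr_gt0 divr_gt0// exprn_gt0// noise_std_gt0.
Qed.

Lemma noise_pair_law (B : set (R * R)) : measurable B ->
  Pr p ((@complex_pair R \o noise p) @^-1` B) = NN B.
Proof.
have [ind lX lY] := noise_gaussian p.
have mZ := measurableT_comp measurable_complex_pair (measurable_funPT (noise p)).
have mX := measurableT_comp measurable_fst mZ.
have mY := measurableT_comp measurable_snd mZ.
move=> mB.
exact: (independent_joint_law (m1 := N0) (m2 := N0) mX mY lX lY ind mB).
Qed.

Lemma secret_noise_law (B : set (R * (R * R))) : measurable B ->
  Pr p ((fun w => (S w, @complex_pair R (noise p w))) @^-1` B) =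
  (distribution (Pr p) S \x NN)%E B.
Proof.
have mZ := measurableT_comp measurable_complex_pair (measurable_funPT (noise p)).
have lS A : measurable A -> Pr p (S @^-1` A) = distribution (Pr p) S A by [].
move=> mB; apply: (independent_joint_law (m1 := distribution (Pr p) S) (m2 := NN)
  (measurable_funPT S) mZ lS noise_pair_law _ mB).
move=> A C mA mC; apply: (@secret_noise_indep R p A (@complex_pair R @^-1` C) mA).
by exists C => //; rewrite setTI.
Qed.

(** The secret and the noise have a product joint law, so the event is measured by integrating its
    sections over the secret. The section at [u] is the [share_map] preimage of [B] when [u] is in
    [U], and empty otherwise. *)
Lemma share_joint_law (U : set R) (B : set (R * R)) : measurable U -> measurable B ->
  Pr p (S @^-1` U `&` share i @^-1` (@complex_pair R @^-1` B)) =
  (\int[distribution (Pr p) S]_(u in U) (noisy_prob c d sd B u)%:E)%E.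
Proof.
move=> mU mB.
have mW := measurable_share_event c d mU mB.
transitivity (Pr p ((fun w => (S w, @complex_pair R (noise p w))) @^-1`
    [set w | U w.1 /\ B (share_map c d w.1 w.2)])).
  congr (Pr p _); apply/seteqP.
  suff E w : complex_pair (share i w) =
      share_map c d (S w) (@complex_pair R (noise p w)).
    by split=> w /=; rewrite E.
  rewrite /share_map /share /complex_pair /c /d /S.
  case: (omega p i) => a b; case: (noise p w) => x y /=.
  by rewrite add0r.
rewrite secret_noise_law// /product_measure1 [RHS]integral_mkcond.
apply: eq_integral => u _ /=; rewrite patchE.
case: ifPn => [|/negP] uU.
  rewrite /noisy_prob fineK; last first.
    by apply: (fin_num_measure NN); exact: measurable_share_map_preimage.
  rewrite inE in uU; congr (NN _); apply/seteqP.
  split => z; rewrite /xsection /= inE /=.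
    by case.
  by move=> ?; split.
rewrite (_ : xsection _ u = set0) ?measure0//; apply/seteqP; split => z //.
by rewrite /xsection /= inE /= => -[/mem_set/uU].
Qed.

Lemma share_lawE (s : R) (B : set (R * R)) : measurable B ->
  support_rv (Pr p) S s ->
  share_law p i s (@complex_pair R @^-1` B) = (noisy_prob c d sd B s)%:E.
Proof.
move=> mB; apply: cond_lawE.
- exact: measurable_noisy_prob.
- by move=> u; apply: fine_ge0; exact: (measure_ge0 NN).
- by move=> u; apply: noisy_prob_lipschitz => //;
    [exact: omega_norm | exact: noise_sd_neq0].
- by move=> U mU; exact: share_joint_law.
Qed.

Lemma share_law_tv (s1 s2 : R) :
  support_rv (Pr p) S s1 -> support_rv (Pr p) S s2 ->
  (total_variation_dist (share_law p i s1) (share_law p i s2) <=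
   (Num.sqrt (2 * (1 - expR (- (range_bound p ^+ 2 / noise_std p ^+ 2)))))%:E)%E.
Proof.
(* By construction, the measurable sets of [R[i]] are the preimages of plane Borel sets [B]. *)
move=> sS1 sS2; apply: ge_ereal_sup => _ [_ [B mB <-] <-].
rewrite setTI !share_lawE// -EFinB abse_EFin lee_fin.
apply: le_trans (noisy_prob_tv s1 s2 omega_norm noise_sd_neq0 mB) _.
rewrite ler_wsqrtr// ler_wpM2l// lerD2l lerN2 ler_expR lerN2.
rewrite sqr_sqrtr ?divr_ge0 ?sqr_ge0//.
have n0 : 0 < noise_std p ^+ 2 by rewrite exprn_gt0// noise_std_gt0.
(* The claim becomes [(s1 - s2) ^+ 2 <= (2 * r) ^+ 2] with [r] the range bound, as both secrets lie
   in [[- r, r]]. *)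
rewrite (_ : 8 * (noise_std p ^+ 2 / 2) = 4 * noise_std p ^+ 2); last by field.
rewrite ler_pdivrMr ?mulr_gt0 ?noise_std_gt0// mulrCA divfK ?gt_eqF//.
have /andP[? ?] := support_rv_bounded (@secret_bounded R p) sS1.
have /andP[? ?] := support_rv_bounded (@secret_bounded R p) sS2.
rewrite (_ : 4 * _ = (2 * range_bound p) ^+ 2); last by ring.
by rewrite -subr_ge0 subr_sqr mulr_ge0//; lra.
Qed.

End protocol_metric.

(** * The bound on the metric and its asymptotic form *)

Lemma ds_metric_le (R : realType) (p : protocol R) :
  (ds_metric p <=
   (Num.sqrt (2 * (1 - expR (- (range_bound p ^+ 2 / noise_std p ^+ 2)))))%:E)%E.
Proof.
apply: bigmax_le; first exact: leNye.
move=> i _; apply: ge_ereal_sup => _ [s1 sS1 [s2 sS2 <-]].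
exact: share_law_tv.
Qed.

(** Total mass 1 makes the sample space nonempty, and any sample gives [- r <= r] for the range
    bound [r]. *)
Lemma range_bound_ge0 (R : realType) (p : protocol R) : 0 <= range_bound p.
Proof.
have [w _] : [set: Omega p] !=set0.
  apply/set0P/eqP => O0; have := probability_setT (Pr p).
  by rewrite O0 measure0 => /eqP; rewrite eq_sym onee_eq0.
by have := @secret_bounded R p w => /andP[? ?]; lra.
Qed.

Theorem theorem2 (R : realType) :
  (forall p : protocol R,
     (ds_metric p <=
        (Num.sqrt (2 * (1 - expR (- (range_bound p ^+ 2 / noise_std p ^+ 2)))))%:E)%E)
  /\
  (forall (T : Type) (F : filter_on T) (p : T -> protocol R),
     ((fun t => range_bound (p t)) : T -> R^o)
       =o_F ((fun t => noise_std (p t)) : T -> R^o) ->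
     exists err : T -> R^o,
       err =o_F ((fun t => range_bound (p t) / noise_std (p t)) : T -> R^o) /\
       forall t, (ds_metric (p t) <=
         (Num.sqrt 2 * (range_bound (p t) / noise_std (p t)) + err t)%:E)%E).
Proof.
split=> [p|T F p _]; first exact: ds_metric_le.
exists (fun=> 0); split.
  apply/eqoP => e e0; near=> t; rewrite normr0 mulr_ge0// ltW//.
move=> t; apply: le_trans (ds_metric_le (p t)) _.
rewrite lee_fin addr0 -expr_div_n.
(* Applied at [x = r / sigma], which is its own absolute value because [r] is nonnegative. *)
apply: le_trans (sqrt_one_sub_gauss_le _) _; rewrite ger0_norm//.
by rewrite divr_ge0 ?range_bound_ge0 ?ltW ?noise_std_gt0.
Unshelve. all: by end_near. Qed.
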